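(* Let $\Phi=(G,\varphi)$ be a complex unit gain graph and let $C_p^{\varphi}$ be a pendant cycle of $\Phi$ of order $p$, with $v$ the unique vertex of $C_p$ of degree $3$ in $G$. Let $F^{\varphi}=(F,\varphi)=\Phi-C_p^{\varphi}$ (delete all vertices of $C_p$) and $H^{\varphi}=(H,\varphi)=F^{\varphi}+v$ (the induced subgraph on $V(F)\cup\{v\}$). If $r(\Phi)=r(G)+2\theta(G)$, then (a) $C_p^{\varphi}$ is of Type B with $p\equiv 0\pmod 4$; (b) $r(H^{\varphi})=r(H)+2\theta(H)$ and $r(F^{\varphi})=r(F)+2\theta(F)$; (c) $r(\Phi)=p+r(F^{\varphi})$, $r(F^{\varphi})=r(H^{\varphi})$, $r(G)=p-2+r(H)$ and $r(F)=r(H)$.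
   Context: A complex unit gain graph $\Phi=(G,\varphi)$ consists of a finite simple graph $G$ with vertex set $\{v_1,\dots,v_n\}$ and a gain function $\varphi$ assigning to each oriented edge $e_{ij}$ ($v_iv_j\in E(G)$) a complex number of modulus $1$ with $\varphi(e_{ji})=\overline{\varphi(e_{ij})}$. $A(\Phi)$ is the Hermitian matrix with $(i,j)$ entry $\varphi(e_{ij})$ if $v_iv_j\in E(G)$ and $0$ otherwise; $r(\Phi)$ is its rank; $r(\cdot)$ of a simple graph is the rank of its $0$-$1$ adjacency matrix. Induced subgraphs of $\Phi$ carry the gains of $\Phi$. $\theta(G)=|E(G)|-|V(G)|+\omega(G)$, $\omega(G)$ the number of components. A pendant cycle of $G$ is an induced subgraph $C_p$ that is a cycle and has a unique vertex of degree $3$ in $G$ (its other vertices having degree $2$ in $G$). For a gain cycle with vertices $v_1,\dots,v_p$ in cyclic order, $\varphi(C_p)=\varphi(e_{12})\cdots\varphi(e_{p1})$; for $p$ even it is of Type B if $\varphi(C_p)\neq(-1)^{p/2}$. *)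

(* Defs.v *)
From HB Require Import structures.
From mathcomp Require Import all_boot all_order all_algebra.
From mathcomp Require Import complex.
From mathcomp Require Import reals.
Set Implicit Arguments.
Unset Strict Implicit.
Unset Printing Implicit Defensive.
Import Order.TTheory GRing.Theory Num.Theory.
Local Open Scope ring_scope.

Section GainGraphs.
Variables (C : numClosedFieldType) (n : nat).
Implicit Types (A : 'M[C]_n) (S : {set 'I_n}).

(* A is the adjacency matrix A(Phi) of a complex unit gain graph on 'I_n:
   Hermitian (phi(e_ji) = conj phi(e_ij)), zero diagonal (simple graph),
   nonzero entries (= edges) of modulus 1. *)
Definition is_gain_graph A : Prop :=
  [/\ forall i, A i i = 0,
      forall i j, A j i = (A i j)^* &
      forall i j, A i j != 0 -> `|A i j| = 1].

Definition adjb A (i j : 'I_n) : bool := A i j != 0.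

Definition underlying A : 'M[C]_n := \matrix_(i, j) (adjb A i j)%:R.

Definition sub_on S (M : 'M[C]_n) : 'M[C]_#|S| :=
  \matrix_(i < #|S|, j < #|S|) M (enum_val i) (enum_val j).

(* rank of the induced subgraph on S, of the gain graph (M = A) or
   of the underlying graph (M = underlying A) *)
Definition rank_on S (M : 'M[C]_n) : nat := \rank (sub_on S M).

Definition nedges A S : nat :=
  #|[set p : 'I_n * 'I_n |
      [&& p.1 \in S, p.2 \in S, (p.1 < p.2)%N & adjb A p.1 p.2]]|.

Definition ncomp A S : nat :=
  n_comp [rel i j | [&& i \in S, j \in S & adjb A i j]] (mem S).

Definition theta A S : nat := (nedges A S + ncomp A S - #|S|)%N.

Definition deg A (x : 'I_n) : nat := #|[set y | adjb A x y]|.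

(* c (listed in cyclic order) spans a pendant cycle of G whose unique
   vertex of degree 3 in G is v: the induced subgraph on the vertices of c
   is the cycle c, v has degree 3 and all other vertices of c degree 2. *)
Definition pendant_cycle A (c : seq 'I_n) (v : 'I_n) : Prop :=
  [/\ (3 <= size c)%N, uniq c, v \in c,
      (forall x y, x \in c -> y \in c ->
         adjb A x y = (y == next c x) || (x == next c y)) &
      deg A v = 3%N /\
      (forall x, x \in c -> x != v -> deg A x = 2%N)].

Definition cycle_gain A (c : seq 'I_n) : C :=
  \prod_(x <- c) A x (next c x).

Definition typeB A (c : seq 'I_n) : bool :=
  ~~ odd (size c) && (cycle_gain A c != (-1) ^+ (size c)./2).

Definition Fset (c : seq 'I_n) : {set 'I_n} := [set x | x \notin c].
Definition Hset (c : seq 'I_n) (v : 'I_n) : {set 'I_n} := v |: Fset c.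

End GainGraphs.

(* Main.v *)
Require Import Defs.
From HB Require Import structures.
From mathcomp Require Import all_boot all_order all_algebra.
From mathcomp Require Import complex.
From mathcomp Require Import reals.
From mathcomp Require Import ring zify.
Set Implicit Arguments.
Unset Strict Implicit.
Unset Printing Implicit Defensive.
Import Order.TTheory GRing.Theory Num.Theory.
Local Open Scope ring_scope.

(** Let U be the 0-1 adjacency matrix of G and p the length of the cycle.

    A spanning forest can be switched to have all gains 1, so A(Phi) is
    congruent to U up to theta(G) edges, each of which changes the rank by at
    most 2: r(Phi) <= r(G) + 2 theta(G) for every gain graph.

    The path left by removing v from the cycle is eliminated two vertices at a
    time, which shortens the cycle by 2 and negates its gain. For even p one
    path vertex remains, joined to v by a weight that vanishes iff the gain is
    (-1)^(p/2); hence r(Phi) is p - 2 + r(H) in that case and p + r(F)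
    otherwise. For odd p the path disappears and leaves a loop at v. The same
    holds for U, whose cycle gain is 1.

    Since theta(F) <= theta(H) < theta(G), comparing both ranks with the bound
    for F and H excludes odd p (a loop changes the rank by at most 1), p = 2
    mod 4 and gain (-1)^(p/2), and forces equality in the remaining case. *)

(** * Rank-one updates and elimination of vertices *)

(** Row [b] of the sum is a nonzero multiple of [q], so the row space is that of [N] plus the line
    of [q]; this sum is direct because column [a] vanishes on [N] but not on [q]. *)
Lemma mxrank_add_rank1 (K : fieldType) m n (N : 'M[K]_(m, n))
    (p : 'cV_m) (q : 'rV_n) (a : 'I_n) (b : 'I_m) :
  row b N = 0 -> col a N = 0 -> p b 0 != 0 -> q 0 a != 0 ->
  \rank (N + p *m q)%R = (\rank N).+1.
Proof.
move=> rb ca pb qa.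
have colu (u : 'rV_n) : (u <= N)%MS -> u 0 a = 0.
  case/submxP=> D ->; rewrite mxE big1 // => k _.
  by have /colP/(_ k) := ca; rewrite !mxE => ->; rewrite mulr0.
have q_sub : (q <= (N + p *m q)%R)%MS.
  have : (p b 0 *: q <= (N + p *m q)%R)%MS.
    suff -> : p b 0 *: q = row b (N + p *m q) by exact: row_sub.
    by rewrite linearD /= rb add0r; apply/rowP=> j; rewrite !mxE big_ord1.
  by rewrite eqmx_scale.
have eqs : ((N + p *m q)%R :=: addsmx N q)%MS.
  apply/eqmxP/andP; split; first by rewrite addmx_sub_adds ?submxMl.
  rewrite addsmx_sub q_sub andbT -{1}[N](addrK (p *m q)).
  by rewrite addmx_sub // eqmx_opp mulmx_sub.
rewrite eqs mxrank_disjoint_sum.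
  by rewrite rank_rV (contraNneq _ qa) ?addn1 // => ->; rewrite mxE.
apply/eqP/rowV0P => u; rewrite sub_capmx => /andP[/colu ua /sub_rVP[k uk]].
move: ua; rewrite uk mxE => /eqP; rewrite mulf_eq0 (negPf qa) orbF => /eqP ->.
by rewrite scale0r.
Qed.

Section Edges.
Variables (K : fieldType) (n : nat).
Implicit Types (N : 'M[K]_n) (a b v z : 'I_n).

(** The two weights are independent, so that elimination need not track their conjugacy; [i = j]
    gives a loop of weight [s + t]. *)
Definition edge_mx i j (s t : K) : 'M[K]_n :=
  s *: delta_mx i j + t *: delta_mx j i.

Lemma row_edge_mx x i j s t : x != i -> x != j -> row x (edge_mx i j s t) = 0.
Proof.
by move=> xi xj; apply/rowP=> k; rewrite !mxE (negPf xi) (negPf xj) !andFb !mulr0 addr0.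
Qed.

Lemma col_edge_mx x i j s t : x != i -> x != j -> col x (edge_mx i j s t) = 0.
Proof.
by move=> xi xj; apply/colP=> k; rewrite !mxE (negPf xi) (negPf xj) !andbF !mulr0 addr0.
Qed.

Lemma row_delta_mx_neq x i j : x != i -> row x (delta_mx i j : 'M[K]_n) = 0.
Proof. by move=> xi; apply/rowP=> k; rewrite !mxE (negPf xi). Qed.

Lemma col_delta_mx_neq x i j : x != j -> col x (delta_mx i j : 'M[K]_n) = 0.
Proof. by move=> xi; apply/colP=> k; rewrite !mxE (negPf xi) andbF. Qed.

(* Gaussian elimination of two adjacent vertices a, b of degree 2; v = z is
   allowed, in which case a loop appears at v. *)
Lemma mxrank_elim N a b v z (s s' t t' u u' : K) :
  a != b -> a != v -> a != z -> b != v -> b != z ->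
  row a N = 0 -> row b N = 0 -> col a N = 0 -> col b N = 0 ->
  t != 0 -> t' != 0 ->
  \rank (N + edge_mx v a s s' + edge_mx a b t t' + edge_mx b z u u')%R
  = (\rank (N + edge_mx v z (- (s * u / t')) (- (u' * s' / t)))%R).+2.
Proof.
move=> ab av az bv bz ra rb ca cb t0 t'0.
pose D (i j : 'I_n) : 'M[K]_n := delta_mx i j.
(* Two rank-one updates lead from [M2] to the full matrix: [M1] restores row [a] and column [b],
   then [M0] restores row [b] and column [a]. Their extra entries at [(z, v)] and [(v, z)] cancel
   the new edge of [M2]. *)
pose M2 := N + edge_mx v z (- (s * u / t')) (- (u' * s' / t)).
pose M1 := M2 + (t *: delta_mx a 0 + u' *: delta_mx z 0 : 'cV_n) *m
   ((s' / t) *: delta_mx 0 v + delta_mx 0 b : 'rV_n).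
pose M0 := M1 + (s *: delta_mx v 0 + t' *: delta_mx b 0 : 'cV_n) *m
   (delta_mx 0 a + (u / t') *: delta_mx 0 z : 'rV_n).
have ba : b != a by rewrite eq_sym.
have zer (x : 'I_n) : x != v -> x != z -> row x N = 0 -> col x N = 0 ->
    row x M2 = 0 /\ col x M2 = 0.
  by move=> xv xz rx cx; rewrite /M2 (linearD (row x)) (linearD (col x)) /= rx cx
    row_edge_mx ?col_edge_mx // !addr0.
have [rM2a cM2a] := zer _ av az ra ca.
have [rM2b cM2b] := zer _ bv bz rb cb.
have E1 : M1 = M2 + (s' *: D a v + t *: D a b + (u' * s' / t) *: D z v + u' *: D z b).
  rewrite /M1 mulmxDl !mulmxDr -!scalemxAl -!scalemxAr !mul_delta_mx !scalerA.
  by rewrite !addrA [t * _]mulrC divfK // -mulrA.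
have E0 : M0 = M1 + (s *: D v a + (s * u / t') *: D v z + t' *: D b a + u *: D b z).
  rewrite /M0 mulmxDl !mulmxDr -!scalemxAl -!scalemxAr !mul_delta_mx !scalerA.
  by rewrite !addrA [t' * _]mulrC divfK // -mulrA.
have -> : N + edge_mx v a s s' + edge_mx a b t t' + edge_mx b z u u' = M0.
  rewrite E0 E1 /M2 /edge_mx -/(D _ _).
  apply/matrixP=> i j; rewrite !mxE.
  ring.
rewrite (@mxrank_add_rank1 _ _ _ _ _ _ a b).
- rewrite (@mxrank_add_rank1 _ _ _ _ _ _ b a) //.
  + by rewrite !mxE !eqxx (negPf az) /= mulr1 mulr0 addr0.
  + by rewrite !mxE !eqxx (negPf bv) /= mulr0 add0r oner_eq0.
- rewrite E1 linearD /= rM2b add0r !linearD !linearZ /=.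
  by rewrite !row_delta_mx_neq // !scaler0 !addr0.
- rewrite E1 linearD /= cM2a add0r !linearD !linearZ /=.
  by rewrite !col_delta_mx_neq // !scaler0 !addr0.
- by rewrite !mxE !eqxx (negPf bv) /= mulr1 mulr0 add0r.
- by rewrite !mxE !eqxx (negPf az) /= mulr0 addr0 oner_eq0.
Qed.

(** Deletion of a pendant vertex [x] together with its neighbour [v]: [r] and [k] hold the row and
    the column of [v], and each is absorbed into a rank-one update along the edge [v x]. *)
Lemma mxrank_pendant N (P : 'M[K]_n) (r : 'rV_n) (k : 'cV_n) v x (s s' : K) :
  N = P + delta_mx v 0 *m r + k *m delta_mx 0 v ->
  row v P = 0 -> col v P = 0 -> row x P = 0 -> col x P = 0 ->
  k v 0 = 0 -> k x 0 = 0 -> r 0 x = 0 ->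
  x != v -> s != 0 -> s' != 0 ->
  \rank (N + edge_mx v x s s')%R = (\rank P).+2.
Proof.
move=> -> rvP cvP rxP cxP kv kx rx xv s0 s'0.
have vx : v != x by rewrite eq_sym.
pose M1 := P + (k + s' *: delta_mx x 0) *m (delta_mx 0 v : 'rV_n).
have -> : P + delta_mx v 0 *m r + k *m delta_mx 0 v + edge_mx v x s s'
   = M1 + (delta_mx v 0 : 'cV_n) *m (r + s *: delta_mx 0 x).
  rewrite /M1 mulmxDl mulmxDr -scalemxAl -scalemxAr !mul_delta_mx /edge_mx.
  by apply/matrixP=> i j; rewrite !mxE; ring.
rewrite (@mxrank_add_rank1 _ _ _ _ _ _ x v).
- rewrite (@mxrank_add_rank1 _ _ _ _ _ _ v x) //.
  + by rewrite !mxE !eqxx kx /= add0r mulr1.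
  + by rewrite !mxE !eqxx /= oner_eq0.
- rewrite linearD /= rvP add0r row_mul.
  suff -> : row v (k + s' *: delta_mx x 0) = 0 by rewrite mul0mx.
  by apply/rowP=> j; rewrite !mxE ord1 kv (negPf vx) /= mulr0 addr0.
- by rewrite linearD /= cxP add0r colE -mulmxA mul_delta_mx_0 // mulmx0.
- by rewrite !mxE !eqxx oner_eq0.
- by rewrite !mxE !eqxx rx /= add0r mulr1.
Qed.
End Edges.

(** * Walks as lists of consecutive pairs *)

Section Walks.
Variable T : eqType.
Implicit Types (x w : T) (s : seq T).

Fixpoint walk x s w : seq (T * T) :=
  if s is y :: s' then (x, y) :: walk y s' w else [:: (x, w)].

Lemma walk_zip x s w : walk x s w = zip (x :: s) (rcons s w).
Proof. by elim: s x => //= y s IHs x; rewrite IHs. Qed.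

Lemma mem_walk x s w e :
  e \in walk x s w -> (e.1 \in x :: s) && (e.2 \in rcons s w).
Proof.
rewrite walk_zip => es; apply/andP; split.
  by have := map_f fst es; rewrite -/(unzip1 _) unzip1_zip //= size_rcons.
by have := map_f snd es; rewrite -/(unzip2 _) unzip2_zip //= size_rcons.
Qed.

Lemma walk_next x s :
  uniq (x :: s) -> [seq (y, next (x :: s) y) | y <- x :: s] = walk x s x.
Proof.
move=> Us; rewrite walk_zip; apply: (@eq_from_nth _ (x, x)) => [|i].
  by rewrite size_map size_zip /= size_rcons minnn.
rewrite size_map => lti; rewrite (nth_map x) // nth_zip /= ?size_rcons //.
congr (_, _); rewrite -/(next (x :: s) _) next_nth mem_nth // index_uniq //.
rewrite nth_rcons; case: ltngtP => // [gti|->]; last by rewrite nth_default.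
by move: lti; rewrite /= ltnS leqNgt gti.
Qed.
End Walks.

(** * Elimination along a path of vertices of degree 2 *)

Section GainWalks.
Variables (C : numClosedFieldType) (n : nat) (A : 'M[C]_n).
Hypothesis gA : is_gain_graph A.
Implicit Types (N : 'M[C]_n) (x v y : 'I_n) (s : seq 'I_n).

Lemma gain_sym i j : A j i = (A i j)^*.
Proof. by case: gA. Qed.

Lemma adjb_sym : symmetric (adjb A).
Proof. by move=> i j; rewrite /adjb (gain_sym j i) fmorph_eq0. Qed.

Lemma adjbxx i : adjb A i i = false.
Proof. by rewrite /adjb; case: gA => -> _ _; rewrite eqxx. Qed.

Lemma gain_mul1 i j : adjb A i j -> A i j * A j i = 1.
Proof.
move=> ij; rewrite (gain_sym i j) -normCK.
by case: gA => _ _ /(_ _ _ ij) ->; rewrite expr1n.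
Qed.

Lemma gain_inv i j : adjb A i j -> (A i j)^-1 = A j i.
Proof. by move=> ij; rewrite -[LHS]mulr1 -(gain_mul1 ij) mulKf. Qed.

Definition chain_mx x s w : 'M[C]_n :=
  \sum_(e <- walk x s w) edge_mx e.1 e.2 (A e.1 e.2) (A e.2 e.1).

Lemma chain_mx_cons x y s w :
  chain_mx x (y :: s) w = edge_mx x y (A x y) (A y x) + chain_mx y s w.
Proof. by rewrite /chain_mx /= big_cons. Qed.

Lemma chain_mx0 x w : chain_mx x [::] w = edge_mx x w (A x w) (A w x).
Proof. by rewrite /chain_mx /= big_seq1. Qed.

Lemma row_col_chain_mx y x s w : y \notin x :: s -> y != w ->
  row y (chain_mx x s w) = 0 /\ col y (chain_mx x s w) = 0.
Proof.
move=> ys yw; rewrite /chain_mx !linear_sum /= big_seq [in X in _ /\ X]big_seq.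
suff ye e : e \in walk x s w -> (y != e.1) && (y != e.2).
  by split; apply: big1 => e /ye/andP[y1 y2]; rewrite (row_edge_mx, col_edge_mx).
case/mem_walk/andP => e1 e2; apply/andP; split.
  by apply: contraNneq ys => ->.
apply: contraNneq ys => ye; move: e2; rewrite mem_rcons inE -ye (negPf yw) /=.
by rewrite inE => ->; rewrite orbT.
Qed.

Lemma edge_mx_addC x v (s s' t t' : C) :
  edge_mx v x s s' + edge_mx x v t t' = edge_mx v x (s + t') (s' + t).
Proof. by apply/matrixP=> i j; rewrite !mxE; ring. Qed.

Lemma edge_mx_loop v (s t : C) : edge_mx v v s t = (s + t) *: delta_mx v v.
Proof. by rewrite /edge_mx scalerDl. Qed.

(** The inverse of a unit gain is the reverse gain, so the quotients of [mxrank_elim] become negated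
    products along [x], [b], [z]. The case [z = v] stays allowed: it closes an odd cycle. *)
Lemma mxrank_chain_step N x b v z r t t' :
  uniq [:: v; x; b] -> z != x -> z != b -> adjb A x b ->
  row x N = 0 -> row b N = 0 -> col x N = 0 -> col b N = 0 ->
  r = N + edge_mx v x t t' + edge_mx x b (A x b) (A b x)
       + edge_mx b z (A b z) (A z b) ->
  \rank r = (\rank (N + edge_mx v z (- (t * (A x b * A b z)))
                          (- (t' * (A b x * A z b))))%R).+2.
Proof.
rewrite /= !inE !negb_or andbT => /andP[/andP[vx vb] xb] zx zb aab rx rb cx cb ->.
have abx : adjb A b x by rewrite adjb_sym.
rewrite mxrank_elim ?[_ == v]eq_sym ?[_ == z]eq_sym //.
congr (\rank (N + edge_mx v z _ _)%R).+2.
  by rewrite (gain_inv abx); ring.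
by rewrite (gain_inv aab); ring.
Qed.

(** The rest of the chain avoids [x] and [b] and so counts as part of [N]; the edge at [v] carries
    the gain accumulated so far. *)
Lemma mxrank_chain_step2 N x b z s v (t t' : C) :
  uniq [:: v, x, b, z & s] -> adjb A x b ->
  {in [:: x, b, z & s], forall y, row y N = 0 /\ col y N = 0} ->
  \rank (N + edge_mx v x t t' + chain_mx x [:: b, z & s] v)%R =
  (\rank (N + edge_mx v z (- (t * (A x b * A b z))) (- (t' * (A b x * A z b)))
           + chain_mx z s v)%R).+2.
Proof.
rewrite /= !inE !negb_or => /and4P[/and4P[vx vb vz vs] /and3P[xb xz xs]
  /andP[bz bs] /andP[zs Us]] axb N0.
have [rx cx] : row x N = 0 /\ col x N = 0 by apply: N0; rewrite !inE eqxx.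
have [rb cb] : row b N = 0 /\ col b N = 0 by apply: N0; rewrite !inE eqxx ?orbT.
have [] := @row_col_chain_mx x z s v; rewrite ?inE ?negb_or ?xz // 1?eq_sym //.
move=> rcx ccx.
have [] := @row_col_chain_mx b z s v; rewrite ?inE ?negb_or ?bz // 1?eq_sym //.
move=> rcb ccb; rewrite !chain_mx_cons.
rewrite (@mxrank_chain_step (N + chain_mx z s v) x b v z _ t t').
- by rewrite addrAC.
- by rewrite /= !inE negb_or vx vb xb.
- by rewrite eq_sym.
- by rewrite eq_sym.
- by [].
- by rewrite linearD /= rx rcx addr0.
- by rewrite linearD /= rb rcb addr0.
- by rewrite linearD /= cx ccx addr0.
- by rewrite linearD /= cb ccb addr0.
- by rewrite !addrA -!(addrAC _ (chain_mx z s v)).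
Qed.

(** Each of the [(size s)./2] steps negates the accumulated weight. At the end [v] and the last
    vertex are joined both by the accumulated edge and by the closing edge of the chain; these
    merge, and the gain of the closing edge is factored out. *)
Lemma mxrank_chain_even N x s v (t t' : C) :
  uniq (v :: x :: s) -> path (adjb A) x (rcons s v) ->
  {in x :: s, forall y, row y N = 0 /\ col y N = 0} -> ~~ odd (size s) ->
  \rank (N + edge_mx v x t t' + chain_mx x s v)%R = (size s +
    \rank (N + edge_mx v (last x s)
      ((1 + (-1) ^+ (size s)./2 * t * \prod_(e <- walk x s v) A e.1 e.2)
         * A v (last x s))
      ((1 + (-1) ^+ (size s)./2 * t' * \prod_(e <- walk x s v) A e.2 e.1)
         * A (last x s) v))%R)%N.
Proof.
have [m] := ubnP (size s); elim: m x s t t' => // m IHm x [|b [|z s]] t t' //.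
  move=> _ _ /andP[xv _] _ _; have vx : adjb A v x by rewrite adjb_sym.
  rewrite chain_mx0 !big_seq1 -addrA edge_mx_addC add0n expr0.
  congr (\rank (N + edge_mx v x _ _)%R).
    by rewrite !mul1r mulrDl -mulrA gain_mul1 // mul1r mulr1 addrC.
  by rewrite !mul1r mulrDl -mulrA gain_mul1 // mul1r mulr1 addrC.
move=> lts U /and3P[xb bz pz] N0 odds; rewrite mxrank_chain_step2 // IHm //.
- rewrite !big_cons /= !exprS.
  congr (_ + \rank (_ + edge_mx v _ (_ * _) (_ * _))%R).+2%N; ring.
- by move: lts; rewrite !ltnS; apply: leq_trans.
- by move: U; rewrite /= !inE !negb_or => /and4P[/and4P[_ _ -> ->] _ _ ->].
- by move=> y ys; apply: N0; rewrite !inE -in_cons ys !orbT.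
- by move: odds; rewrite /= negbK.
Qed.

(** The last step has [z = v], so its new edge is a loop. The weight [l] is left unspecified, since
    any loop changes the rank by at most 1. *)
Lemma mxrank_chain_odd N x s v (t t' : C) :
  uniq (v :: x :: s) -> path (adjb A) x (rcons s v) ->
  {in x :: s, forall y, row y N = 0 /\ col y N = 0} -> odd (size s) ->
  exists l : C, \rank (N + edge_mx v x t t' + chain_mx x s v)%R =
    ((size s).+1 + \rank (N + l *: delta_mx v v)%R)%N.
Proof.
have [m] := ubnP (size s); elim: m x s t t' => // m IHm x [|b [|z s]] t t' //.
  move=> _ U /and3P[xb _ _] N0 _.
  have [rx cx] : row x N = 0 /\ col x N = 0 by apply: N0; rewrite !inE eqxx.
  have [rb cb] : row b N = 0 /\ col b N = 0 by apply: N0; rewrite !inE eqxx ?orbT.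
  move: (U); rewrite /= !inE negb_or andbT => /andP[/andP[vx vb] _].
  rewrite chain_mx_cons chain_mx0 (@mxrank_chain_step N x b v v _ t t') //.
    by rewrite edge_mx_loop; eexists; rewrite /= !addSn add0n; reflexivity.
  by rewrite !addrA.
move=> lts U /and3P[xb bz pz] N0 odds; rewrite mxrank_chain_step2 //.
have [] := IHm z s (- (t * (A x b * A b z))) (- (t' * (A b x * A z b))) => //.
- by move: lts; rewrite !ltnS; apply: leq_trans.
- by move: U; rewrite /= !inE !negb_or => /and4P[/and4P[_ _ -> ->] _ _ ->].
- by move=> y ys; apply: N0; rewrite !inE -in_cons ys !orbT.
- by move: odds; rewrite /= negbK.
by move=> l ->; exists l; rewrite /= !addSn.
Qed.
End GainWalks.

(** * Cyclic successors *)

(** Rotating the cycle to start at [v] gives the form on which elimination recurses. The operation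
    is generic because both the gain (a product) and the matrix of the cycle (a sum) are rewritten
    this way. *)
Lemma big_next_walk (T : eqType) (R : Type) (idx : R) (op : Monoid.com_law idx)
    (c : seq T) i v s (G : T -> T -> R) :
  uniq c -> rot i c = v :: s ->
  \big[op/idx]_(y <- c) G y (next c y) = \big[op/idx]_(e <- walk v s v) G e.1 e.2.
Proof.
move=> Uc rotc; rewrite -walk_next; last by rewrite -rotc rot_uniq.
rewrite big_map -rotc.
under [RHS]eq_bigr => y _ do rewrite /= next_rot //.
by apply: perm_big; rewrite perm_sym perm_rot.
Qed.

(** Length at least 3 keeps the two cycle neighbours of a vertex distinct, so that no edge is
    traversed twice. *)
Lemma next_next_neq (T : eqType) (c : seq T) y :
  (3 <= size c)%N -> uniq c -> y \in c -> next c (next c y) != y.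
Proof.
move=> szc Uc yc; have [i s rotc] := rot_to yc.
rewrite -!(next_rot i Uc) rotc.
have : uniq (y :: s) by rewrite -rotc rot_uniq.
have : (3 <= size (y :: s))%N by rewrite -rotc size_rot.
case: s {rotc} => [|a [|b s]] //= _; rewrite eqxx !inE !negb_or.
by case/andP=> /and3P[ya yb _] _; rewrite [a == y]eq_sym (negPf ya) eqxx eq_sym.
Qed.

(** * Induced subgraphs as zero-padded matrices *)

Section Restr.
Variables (K : fieldType) (n : nat).
Implicit Types (S T : {set 'I_n}) (M : 'M[K]_n).

(** Padding with zeros keeps one common size, so that the matrices of F, H and G can be added and
    compared. *)
Definition restr_mx S M : 'M[K]_n :=
  \matrix_(i, j) (if (i \in S) && (j \in S) then M i j else 0).

Lemma row_restr_mx S M y : y \notin S -> row y (restr_mx S M) = 0.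
Proof. by move=> /negPf yS; apply/rowP=> j; rewrite !mxE yS. Qed.

Lemma col_restr_mx S M y : y \notin S -> col y (restr_mx S M) = 0.
Proof. by move=> /negPf yS; apply/colP=> j; rewrite !mxE yS andbF. Qed.

Lemma restr_mxU1 S M v : v \notin S -> M v v = 0 ->
  restr_mx (v |: S) M = restr_mx S M + delta_mx v 0 *m row v (restr_mx (v |: S) M)
                       + col v (restr_mx (v |: S) M) *m delta_mx 0 v.
Proof.
move=> vS Mvv; apply/matrixP=> i j; rewrite !mxE !big_ord1 !mxE !eqxx !inE /=.
have [->|iv] := eqVneq i v; have [->|jv] := eqVneq j v;
  by rewrite ?eqxx ?(negPf vS) ?Mvv ?andbF /= ?mul0r ?mul1r ?mulr0 ?mulr1 ?addr0 ?add0r.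
Qed.

Lemma mxrank_delta_mulmx_leq1 m p (i : 'I_m) (r : 'rV[K]_p) :
  (\rank (delta_mx i 0 *m r)%R <= 1)%N.
Proof. exact: leq_trans (mxrankM_maxr _ _) (rank_leq_row _). Qed.

Lemma mxrank_mulmx_delta_leq1 m p (i : 'I_p) (k : 'cV[K]_m) :
  (\rank (k *m delta_mx 0 i)%R <= 1)%N.
Proof. exact: leq_trans (mxrankM_maxl _ _) (rank_leq_col _). Qed.

Lemma mxrank_restrU1 S M v : v \notin S -> M v v = 0 ->
  (\rank (restr_mx (v |: S) M) <= \rank (restr_mx S M) + 2)%N.
Proof.
move=> vS Mvv; rewrite [in leqLHS]restr_mxU1 //.
apply: leq_trans (mxrank_add _ _) _; rewrite (addnA _ 1 1)%N.
apply: leq_add (mxrank_mulmx_delta_leq1 _ _).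
apply: leq_trans (mxrank_add _ _) _.
by rewrite leq_add2l mxrank_delta_mulmx_leq1.
Qed.

Lemma mxrank_restr_subset S T M : S \subset T ->
  (\rank (restr_mx S M) <= \rank (restr_mx T M))%N.
Proof.
move=> ST; pose P : 'M[K]_n := diag_mx (\row_i (i \in S)%:R).
have -> : restr_mx S M = P *m restr_mx T M *m P.
  apply/matrixP=> i j; rewrite mul_mx_diag mul_diag_mx !mxE.
  have [iS|iS] := boolP (i \in S); last by rewrite !mul0r.
  have [jS|jS] := boolP (j \in S); last by rewrite mulr0.
  by rewrite !(subsetP ST) //= mul1r mulr1.
exact: leq_trans (mxrankM_maxl _ _) (mxrankM_maxr _ _).
Qed.
End Restr.

(** The selection matrix [E] and its transpose transform each of the two matrices into the other, so
    each rank bounds the other. *)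
Lemma rank_onE (C : numClosedFieldType) n (S : {set 'I_n}) (M : 'M[C]_n) :
  rank_on S M = \rank (restr_mx S M).
Proof.
pose E : 'M[C]_(#|S|, n) := \matrix_(i, j) (enum_val i == j)%:R.
have sumE i (F : 'I_n -> C) : \sum_j E i j * F j = F (enum_val i).
  rewrite (bigD1 (enum_val i)) //= mxE eqxx mul1r big1 ?addr0 // => j.
  by rewrite mxE eq_sym => /negPf ->; rewrite mul0r.
have ES : sub_on S M = E *m restr_mx S M *m E^T.
  apply/matrixP=> i j; rewrite !mxE.
  under eq_bigr => k _ do rewrite [X in _ * X]mxE mulrC [X in _ * X]mxE.
  by rewrite sumE sumE mxE !enum_valP.
have SE : restr_mx S M = E^T *m sub_on S M *m E.
  apply/matrixP=> i j; rewrite !mxE.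
  have [iS|iS] := boolP (i \in S); last first.
    rewrite /= big1 // => k _; rewrite mxE big1 ?mul0r // => l _.
    rewrite !mxE; case: eqP => [E1|]; last by rewrite mul0r.
    by rewrite -E1 enum_valP in iS.
  have [jS|jS] := boolP (j \in S); last first.
    rewrite /= big1 // => k _; rewrite [X in _ * X]mxE.
    case: eqP => [E1|]; last by rewrite mulr0.
    by rewrite -E1 enum_valP in jS.
  rewrite /= (bigD1 (enum_rank_in iS j)) //= big1 ?addr0; last first.
    move=> k kj; rewrite [X in _ * X]mxE; case: eqP => [E1|]; last by rewrite mulr0.
    by case/eqP: kj; rewrite -(enum_valK_in iS k) E1.
  rewrite [X in _ * X]mxE enum_rankK_in // eqxx mulr1 mxE.
  rewrite (bigD1 (enum_rank_in iS i)) //= big1 ?addr0; last first.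
    move=> k ki; rewrite !mxE; case: eqP => [E1|]; last by rewrite mul0r.
    by case/eqP: ki; rewrite -(enum_valK_in iS k) E1.
  by rewrite !mxE !enum_rankK_in // eqxx mul1r.
apply/eqP; rewrite eqn_leq; apply/andP; split; [rewrite /rank_on ES|rewrite SE];
  exact: leq_trans (mxrankM_maxl _ _) (mxrankM_maxr _ _).
Qed.

(** * Structure of a pendant cycle and its contribution to the rank *)

Section PendantCycle.
Variables (C : numClosedFieldType) (n : nat) (A : 'M[C]_n) (c : seq 'I_n) (v : 'I_n).
Hypotheses (gA : is_gain_graph A) (pc : pendant_cycle A c v).

Let szc : (3 <= size c)%N. Proof. by case: pc. Qed.
Let Uc : uniq c. Proof. by case: pc. Qed.
Let vc : v \in c. Proof. by case: pc. Qed.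
Let adjc x y : x \in c -> y \in c ->
  adjb A x y = (y == next c x) || (x == next c y).
Proof. by case: pc => _ _ _ H _; apply: H. Qed.

Lemma adjb_next y : y \in c -> adjb A y (next c y).
Proof. by move=> yc; rewrite adjc ?mem_next // eqxx. Qed.

Let cnbr x := [set next c x; prev c x].

Let card_cnbr x : x \in c -> #|cnbr x| = 2%N.
Proof.
move=> xc; rewrite cards2; suff -> : next c x != prev c x by [].
apply: contraTneq (next_next_neq szc Uc xc) => ->.
by rewrite next_prev // eqxx.
Qed.

Let cnbr_sub x : x \in c -> cnbr x \subset [set y | adjb A x y].
Proof.
move=> xc; apply/subsetP=> y; rewrite !inE => /orP[]/eqP->.
  exact: adjb_next.
by rewrite adjc ?mem_prev // next_prev // eqxx orbT.
Qed.

(** The two cycle neighbours already exhaust the degree 2. *)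
Lemma cycle_nbr x y : x \in c -> x != v -> adjb A x y -> y \in c.
Proof.
move=> xc xv xy; have : y \in cnbr x.
  have /eqP -> : cnbr x == [set y | adjb A x y]; last by rewrite inE.
  rewrite eqEcard cnbr_sub // card_cnbr //.
  by case: pc => _ _ _ _ [_ /(_ x xc xv)]; rewrite /deg => ->.
by rewrite !inE => /orP[]/eqP->; rewrite ?mem_next ?mem_prev.
Qed.

(** Two of the three neighbours of [v] are its cycle neighbours; the third lies outside because the
    cycle is induced. *)
Lemma pendant_attach :
  exists2 w, w \notin c & forall y, y \notin c -> adjb A v y = (y == w).
Proof.
have : #|[set y | adjb A v y] :\: cnbr v| == 1%N.
  rewrite cardsD (setIidPr (cnbr_sub vc)) card_cnbr //.
  by case: pc => _ _ _ _ []; rewrite /deg => ->.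
case/cards1P=> w Ew; have outE y : y \notin c -> adjb A v y = (y == w).
  move=> yc; have /setP/(_ y) := Ew; rewrite !inE => <-.
  suff -> : (y == next c v) || (y == prev c v) = false by [].
  by apply: contraNF yc => /orP[]/eqP->; rewrite ?mem_next ?mem_prev.
exists w => //; have /setP/(_ w) := Ew; rewrite !inE eqxx negb_or.
case/andP=> /andP[wn wp] vw; apply: contraL vw => wc.
rewrite adjc // negb_or wn; apply: contraNneq wp => ->.
by rewrite prev_next.
Qed.

(** H and the cycle share only the vertex [v], hence no edge, and an edge leaving the cycle must
    start at [v], so it belongs to H. *)
Lemma pendant_cycle_mx_split : A = restr_mx (Hset c v) A +
  \sum_(y <- c) edge_mx y (next c y) (A y (next c y)) (A (next c y) y).
Proof.
apply/matrixP=> i j; rewrite mxE summxE.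
under eq_bigr => y _ do rewrite !mxE.
have sum1 (F : 'I_n -> C) (k : 'I_n) :
    \sum_(y <- c) (if k == y then F y else 0) = if k \in c then F k else 0.
  have [kc|kc] := boolP (k \in c).
    rewrite (bigD1_seq k) //= eqxx big1 ?addr0 // => y.
    by rewrite eq_sym => /negPf ->.
  by rewrite big_seq big1 // => y yc; case: eqP kc => // ->; rewrite yc.
have -> : \sum_(y <- c) (A y (next c y) * ((i == y) && (j == next c y))%:R
     + A (next c y) y * ((i == next c y) && (j == y))%:R) =
   (if i \in c then A i j * (j == next c i)%:R else 0)
   + (if j \in c then A i j * (i == next c j)%:R else 0).
  rewrite big_split /= -(sum1 (fun y => A y j * (j == next c y)%:R)).
  rewrite -(sum1 (fun y => A i y * (i == next c y)%:R)).
  congr (_ + _); apply: eq_bigr => y _.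
    by case: (i =P y) => [_|_]; case: (j =P next c y) => [<-|_]; rewrite /= ?mulr0.
  by case: (j =P y) => [_|_]; case: (i =P next c y) => [<-|_]; rewrite /= ?mulr0.
rewrite mxE !inE.
have A0 x y : adjb A x y = false -> A x y = 0 by move/negbFE/eqP.
have [ic|ic] := boolP (i \in c); have [jc|jc] := boolP (j \in c).
- rewrite !orbF; case: ifP => [/andP[/eqP -> /eqP ->]|_].
    by rewrite (A0 _ _ (adjbxx gA v)) !mul0r !addr0.
  rewrite add0r -mulrDr; have := adjc ic jc.
  have [Ej|_] := eqVneq j (next c i); have [Ei|_] := eqVneq i (next c j).
  (* Were both successions true, [i] would be its own second successor and the entry would be
     counted twice. *)
  + by have := next_next_neq szc Uc ic; rewrite -Ej -Ei eqxx.
  + by rewrite addr0 mulr1.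
  + by rewrite add0r mulr1.
  + by move/A0=> ->; rewrite mul0r.
- have -> : (j == next c i) = false.
    by apply: contraNF jc => /eqP->; rewrite mem_next.
  rewrite mulr0 !addr0 orbT andbT orbF; case: eqP => // /eqP iv.
  by apply: A0; apply: contraNF jc; apply: cycle_nbr.
- have -> : (i == next c j) = false.
    by apply: contraNF ic => /eqP->; rewrite mem_next.
  rewrite mulr0 !addr0 orbT /= orbF; case: eqP => // /eqP jv.
  apply: A0; apply: contraNF ic; rewrite adjb_sym //.
  exact: cycle_nbr.
- by rewrite !orbT !addr0.
Qed.

Let HsetE y : (y \in Hset c v) = (y == v) || (y \notin c).
Proof. by rewrite !inE. Qed.

Lemma notin_Hset y : y \in c -> y != v -> y \notin Hset c v.
Proof. by move=> yc yv; rewrite HsetE negb_or yv negbK. Qed.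

(** Here [x :: s] is the path left by removing [v]. The edge [v x] is kept apart because its weight
    accumulates the gain during elimination. *)
Lemma pendant_cycle_walk : exists x s,
  [/\ size c = (size s).+2, uniq (v :: x :: s), path (adjb A) x (rcons s v),
      {in x :: s, forall y, y \notin Hset c v} &
      A = restr_mx (Hset c v) A + edge_mx v x (A v x) (A x v) + chain_mx A x s v]
  /\
      cycle_gain A c = A v x * \prod_(e <- walk x s v) A e.1 e.2.
Proof.
have [i [|x s] rotc] := rot_to vc.
  by have := szc; rewrite -(size_rot i) rotc.
have U : uniq (v :: x :: s) by rewrite -rotc rot_uniq.
have mem_c : c =i v :: x :: s by move=> y; rewrite -rotc mem_rot.
exists x, s; split; last first.
  by rewrite /cycle_gain (big_next_walk _ (fun y z => A y z) Uc rotc) big_cons.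
split => //.
- by rewrite -(size_rot i) rotc.
- have : cycle (adjb A) (v :: x :: s).
    apply: cycle_from_next => // y; rewrite -rotc next_rot // mem_rot.
    exact: adjb_next.
  by case/andP.
- move=> y ys; apply: notin_Hset; first by rewrite mem_c inE ys orbT.
  by apply: contraTneq ys => ->; case/andP: U.
rewrite [LHS]pendant_cycle_mx_split -addrA; congr (_ + _).
rewrite (big_next_walk _ (fun y z => edge_mx y z (A y z) (A z y)) Uc rotc).
by rewrite /= big_cons.
Qed.

Lemma mxrank_pendant_cycle_even : ~~ odd (size c) ->
  \rank A = if cycle_gain A c == (-1) ^+ (size c)./2
            then (size c - 2 + \rank (restr_mx (Hset c v) A))%N
            else (size c + \rank (restr_mx (Fset c) A))%N.
Proof.
have [x [s [[sz U p0 sH EA] Eg]]] := pendant_cycle_walk.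
rewrite sz /= negbK => evs; rewrite [in LHS]EA mxrank_chain_even //; last first.
  by move=> y /sH yH; rewrite row_restr_mx ?col_restr_mx.
set g := cycle_gain A c in Eg *.
rewrite -!mulrA -Eg.
(* Traversing the cycle backwards conjugates the gain, so the two weights at the last vertex vanish
   together. *)
have -> : A x v * \prod_(e <- walk x s v) A e.2 e.1 = g^*.
  rewrite Eg rmorphM rmorph_prod /= -gain_sym //; congr (_ * _).
  by apply: eq_bigr => e _; rewrite -gain_sym.
have lv : adjb A (last x s) v by move: p0; rewrite rcons_path => /andP[].
have vl : adjb A v (last x s) by rewrite adjb_sym.
have t_eq0 : (1 + (-1) ^+ (size s)./2 * g == 0) = (g == (-1) ^+ (size s)./2.+1).
  rewrite exprS mulN1r -signr_odd; case: (odd _); rewrite ?expr1 ?expr0.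
    by rewrite mulN1r opprK subr_eq0 eq_sym.
  by rewrite mul1r addrC addr_eq0.
have tc : 1 + (-1) ^+ (size s)./2 * g^* = (1 + (-1) ^+ (size s)./2 * g)^*.
  by rewrite rmorphD rmorph1 rmorphM rmorphXn rmorphN1.
rewrite tc -t_eq0; case: eqP => [->|/eqP t0].
  by rewrite conjC0 !mul0r /edge_mx !scale0r !addr0 subSS subSS subn0.
have lH : last x s \notin Hset c v by apply: sH; rewrite mem_last.
have vF : v \notin Fset c by rewrite inE negbK.
have Avv : A v v = 0 by case: gA.
(* With nonzero weight [last x s] is pendant at [v]; deleting both leaves F, and the 2 gained
   completes [size s] to [size c]. *)
rewrite (mxrank_pendant (restr_mxU1 vF Avv)) ?addnS //.
- exact: row_restr_mx.
- exact: col_restr_mx.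
- by apply: row_restr_mx; apply: contraNN lH; rewrite !inE => ->; rewrite orbT.
- by apply: col_restr_mx; apply: contraNN lH; rewrite !inE => ->; rewrite orbT.
- by rewrite !mxE Avv if_same.
- by rewrite !mxE (negPf lH).
- by rewrite !mxE (negPf lH) andbF.
- by apply: contraNneq lH => ->; rewrite HsetE eqxx.
- by rewrite mulf_neq0.
- by rewrite mulf_neq0 // conjC_eq0.
Qed.

Lemma mxrank_pendant_cycle_odd : odd (size c) ->
  exists l : C, \rank A =
    ((size c).-1 + \rank (restr_mx (Hset c v) A + l *: delta_mx v v)%R)%N.
Proof.
have [x [s [[sz U p0 sH EA] Eg]]] := pendant_cycle_walk.
rewrite sz /= negbK => odds.
have N0 : {in x :: s, forall y, row y (restr_mx (Hset c v) A) = 0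
                               /\ col y (restr_mx (Hset c v) A) = 0}.
  by move=> y /sH yH; rewrite row_restr_mx ?col_restr_mx.
have [l] := mxrank_chain_odd gA (A v x) (A x v) U p0 N0 odds.
by rewrite -EA; exists l.
Qed.
End PendantCycle.

(** * Switching and the bound on the rank of a gain graph *)

Lemma mxrank_leq_card_support (K : fieldType) m n (N : 'M[K]_(m, n)) :
  (\rank N <= #|[set p : 'I_m * 'I_n | (N p.1 p.2 != 0)%R]|)%N.
Proof.
rewrite {1}[N]matrix_sum_delta pair_big /= -sum1_card [leqRHS]big_mkcond /=.
apply: (big_ind2 (fun (M : 'M[K]_(m, n)) (k : nat) => (\rank M <= k)%N)).
- by rewrite mxrank0.
- by move=> M1 k1 M2 k2 le1 le2; apply: leq_trans (mxrank_add _ _) (leq_add _ _).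
move=> p _; rewrite inE; case: eqP => [->|_] /=; first by rewrite scale0r mxrank0.
by apply: leq_trans (mxrank_scale _ _) _; rewrite mxrank_delta.
Qed.

Lemma mxrank_leq_card_sym_support (K : fieldType) n (N : 'M[K]_n)
    (B : {set 'I_n * 'I_n}) :
  (forall i j, N i j != 0 -> ((i, j) \in B) || ((j, i) \in B)) ->
  (\rank N <= 2 * #|B|)%N.
Proof.
move=> NB; apply: leq_trans (mxrank_leq_card_support N) _.
pose sw (p : 'I_n * 'I_n) := (p.2, p.1).
have : [set p | N p.1 p.2 != 0] \subset B :|: sw @: B.
  apply/subsetP=> -[i j]; rewrite !inE /= => /NB/orP[->//|jiB].
  by apply/orP; right; apply/imsetP; exists (j, i).
move/subset_leq_card/leq_trans; apply.
rewrite (leq_trans (leq_card_setU _ _)) // mul2n -addnn leq_add2l.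
exact: leq_imset_card.
Qed.

Section Switching.
Variables (C : numClosedFieldType) (n : nat) (A : 'M[C]_n).
Hypothesis gA : is_gain_graph A.
Implicit Types (S T X : {set 'I_n}) (d : 'I_n -> C).

Definition edge_on S : rel 'I_n := [rel i j | [&& i \in S, j \in S & adjb A i j]].

Lemma edge_on_sym S : symmetric (edge_on S).
Proof. by move=> i j; rewrite /edge_on /= adjb_sym // andbCA. Qed.

Lemma connect_edge_on_sym S : connect_sym (edge_on S).
Proof. exact/sym_connect_sym/edge_on_sym. Qed.

Lemma connect_edge_on_mem S x y : x \in S -> connect (edge_on S) x y -> y \in S.
Proof.
move=> xS cxy; rewrite -(closed_connect _ cxy) //.
by move=> i j /and3P[-> ->].
Qed.

Lemma ncompE S : ncomp A S = #|[set x in S | roots (edge_on S) x]|.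
Proof.
by rewrite cardsE; apply: eq_card => x; rewrite !inE andbC.
Qed.

Definition edges_on S : {set 'I_n * 'I_n} :=
  [set p | [&& p.1 \in S, p.2 \in S, (p.1 < p.2)%N & adjb A p.1 p.2]].

Lemma nedgesE S : nedges A S = #|edges_on S|.
Proof. by []. Qed.

(** For a potential [d] of modulus 1, these edges get gain 1 after switching by [d]. *)
Definition switched d X : {set 'I_n * 'I_n} :=
  [set p in edges_on X | A p.1 p.2 == d p.1 * (d p.2)^*].

Lemma edges_onS S X : S \subset X -> edges_on S \subset edges_on X.
Proof.
move=> /subsetP SX; apply/subsetP=> p; rewrite !inE => /and4P[p1 p2 -> ->].
by rewrite !SX.
Qed.

(* A spanning forest is grown one vertex at a time: a new vertex is either the
   root of its component or the end of an edge leaving X, and in the latter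
   case its potential is chosen so that this edge becomes switched. *)
Lemma switching_exists_from S X d :
  X \subset S -> (forall i, `|d i| = 1) ->
  (#|X| <= #|switched d X| + #|[set x in X | roots (edge_on S) x]|)%N ->
  exists2 d', forall i, `|d' i| = 1
    & (#|S| <= #|switched d' S| + ncomp A S)%N.
Proof.
have [m] := ubnP #|S :\: X|; elim: m X d => // m IHm X d ltm XS d1 leX.
have [SX|] := boolP (S \subset X).
  have EX : X = S by apply/eqP; rewrite eqEsubset XS.
  by exists d => //; rewrite ncompE -{1 2 3}EX.
case/subsetPn=> x xS xX.
have grow z d' : z \in S -> z \notin X -> (forall i, `|d' i| = 1) ->
  (#|X|.+1 <= #|switched d' (z |: X)|
      + #|[set x in z |: X | roots (edge_on S) x]|)%N ->
  exists2 d', forall i, `|d' i| = 1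
    & (#|S| <= #|switched d' S| + ncomp A S)%N.
  move=> zS zX d'1 le'; apply: (IHm (z |: X) d') => //.
  - rewrite -ltnS; apply: leq_trans ltm; rewrite ltnS; apply: proper_card.
    apply/properP; split; first by apply: setDS; apply: subsetUr.
    by exists z; rewrite !inE ?zS ?zX // eqxx.
  - by rewrite subUset sub1set zS.
  - by rewrite cardsU1 zX.
have [/exists_inP[z zS /andP[zX rz]]|noroot] :=
    boolP [exists z in S, (z \notin X) && roots (edge_on S) z].
  apply: (grow z d) => //; apply: leq_ltn_trans leX _; rewrite -addnS.
  apply: leq_add.
    apply: subset_leq_card; apply/subsetP=> p; rewrite !inE.
    by case/andP=> /and4P[-> -> -> ->] ->; rewrite !orbT.
  rewrite -add1n -(cards1 z) -cardsUI.
  rewrite [_ :&: _](_ : _ = set0) ?cards0 ?addn0; last first.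
    by apply/setP=> y; rewrite !inE; case: eqP => // ->; rewrite (negPf zX).
  apply: subset_leq_card; apply/subsetP=> y; rewrite !inE.
  by case: eqP => [->|_] //= /andP[-> ->].
have [y [z [yX zS zX ayz]]] : exists y z,
    [/\ y \in X, z \in S, z \notin X & adjb A y z].
  have [/existsP[y /existsP[z /and4P[]]]|no] := boolP
    [exists y, exists z, [&& y \in X, z \in S, z \notin X & adjb A y z]].
    by exists y, z.
  (* If no edge left [X], it would be a union of components of [S], and the root of [x] would be a
     root outside [X]. *)
  have clX : closed (edge_on S) X.
    apply: (intro_closed (connect_edge_on_sym S)) => i j /and3P[iS jS aij] iX.
    apply: contraNT no => jX; apply/existsP; exists i; apply/existsP; exists j.
    exact/and4P.
  have cxr := connect_root (edge_on S) x.
  case/negP: xX; rewrite (closed_connect clX cxr).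
  apply: contraNT noroot => rX; apply/exists_inP; exists (fingraph.root (edge_on S) x).
    exact: connect_edge_on_mem cxr.
  by rewrite rX roots_root //; apply: connect_edge_on_sym.
pose d' i := if i == z then A z y * d y else d i.
have dd i : d i * (d i)^* = 1 by rewrite -normCK d1 expr1n.
have azy : adjb A z y by rewrite adjb_sym.
have d'X i : i \in X -> d' i = d i.
  by move=> iX; rewrite /d'; case: eqP => // iz; rewrite -iz iX in zX.
have d'z : d' z = A z y * d y by rewrite /d' eqxx.
apply: (grow z d') => //.
  move=> i; rewrite /d'; case: ifP => // _.
  by rewrite normrM d1 mulr1; case: gA => _ _; apply.
pose p := if (y < z)%N then (y, z) else (z, y).
have zy : z != y by apply: contraNneq zX => ->.
have pz : p \notin switched d X.
  by rewrite /p; case: ifP => _; rewrite !inE /= (negPf zX) ?andbF.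
have : p |: switched d X \subset switched d' (z |: X).
  rewrite subUset sub1set; apply/andP; split.
    rewrite /p; case: ltngtP => [ltyz|ltzy|/val_inj/eqP]; last first.
    + by rewrite eq_sym (negPf zy).
    + rewrite !inE /= eqxx yX orbT ltzy azy /= d'z d'X //.
      by rewrite -mulrA dd mulr1.
    + rewrite !inE /= eqxx yX orbT ltyz ayz /= d'z d'X //.
      by rewrite rmorphM /= mulrCA dd mulr1 -gain_sym.
  apply/subsetP=> q; rewrite !inE => /andP[/and4P[q1 q2 -> ->]] /=.
  by rewrite q1 q2 !orbT !d'X.
move/subset_leq_card; rewrite cardsU1 pz add1n => le1.
apply: leq_ltn_trans leX _; rewrite -addSn; apply: leq_add le1 _.
apply: subset_leq_card; apply/subsetP=> i; rewrite !inE => /andP[-> ->].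
by rewrite orbT.
Qed.

Lemma switching_exists S :
  exists2 d, forall i, `|d i| = 1 & (#|S| <= #|switched d S| + ncomp A S)%N.
Proof.
by apply: (@switching_exists_from S set0 (fun=> 1)); rewrite ?sub0set ?cards0 //;
  move=> i; rewrite normr1.
Qed.

(** Ensures that the natural-number subtraction in [theta] does not truncate. *)
Lemma card_leq_nedges_ncomp S : (#|S| <= nedges A S + ncomp A S)%N.
Proof.
have [d _ /leq_trans] := switching_exists S; apply; rewrite leq_add2r.
by apply: subset_leq_card; apply/subsetP=> p; rewrite inE => /andP[].
Qed.

(** After switching, the two graphs differ only on the at most [theta A S] edges of [B], each worth
    rank 2. The loops at [v] serve the odd cycles; two different loop weights cost 1 more. *)
Lemma mxrank_gain_leq S v (l l' : C) :
  (\rank (restr_mx S A + l *: delta_mx v v)%R <=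
   \rank (restr_mx S (underlying A) + l' *: delta_mx v v)%R
     + 2 * theta A S + (l != l'))%N.
Proof.
have [d d1 leS] := switching_exists S.
pose B := edges_on S :\: switched d S.
have leB : (#|B| <= theta A S)%N.
  have sub : switched d S \subset edges_on S.
    by apply/subsetP=> p; rewrite inE => /andP[].
  have := cardsD (edges_on S) (switched d S).
  rewrite (setIidPr sub) -/B /theta nedgesE => ->.
  by have := subset_leq_card sub; move: leS; lia.
pose D : 'M[C]_n := diag_mx (\row_i d i).
pose D' : 'M[C]_n := diag_mx (\row_i (d i)^*).
pose N := restr_mx S A - D *m restr_mx S (underlying A) *m D'.
have rN : (\rank N <= 2 * theta A S)%N.
  apply: leq_trans (leq_mul (leqnn 2) leB).
  apply: mxrank_leq_card_sym_support => i j.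
  rewrite /N mxE [X in _ + X]mxE mul_mx_diag mul_diag_mx !mxE.
  have [iS|] := boolP (i \in S); last by rewrite /= mulr0 mul0r subr0 eqxx.
  have [jS|] := boolP (j \in S); last by rewrite /= mulr0 mul0r subr0 eqxx.
  rewrite /=; have [aij|] := boolP (adjb A i j); last first.
    by rewrite negbK mulr0 mul0r subr0 => ->.
  have aji : adjb A j i by rewrite adjb_sym.
  rewrite mulr1 subr_eq0 => neq.
  case: (ltngtP i j) => [ltij|ltji|/val_inj ij].
  - by rewrite !inE /= iS jS ltij aij /= neq.
  - rewrite !inE /= iS jS ltji aji /= [X in _ || X]andbT.
    apply/orP; right; apply: contraNneq neq => Eji.
    by rewrite (gain_sym gA j i) Eji rmorphM /= conjCK mulrC.
  - by rewrite ij adjbxx in aij.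
(* A loop is unaffected by switching, since [d v] has modulus 1. *)
have DeD : D *m delta_mx v v *m D' = delta_mx v v.
  apply/matrixP=> i j; rewrite mul_mx_diag mul_diag_mx !mxE.
  have [->|] := eqVneq i v; last by rewrite mulr0 mul0r.
  have [->|] := eqVneq j v; last by rewrite mulr0 mul0r.
  by rewrite mulr1 -normCK d1 expr1n.
have -> : restr_mx S A + l *: delta_mx v v =
    D *m (restr_mx S (underlying A) + l' *: delta_mx v v) *m D' + N
    + (l - l') *: delta_mx v v.
  rewrite mulmxDr mulmxDl -scalemxAr -scalemxAl DeD /N scalerBl.
  by apply/matrixP=> i j; rewrite !mxE; ring.
apply: leq_trans (mxrank_add _ _) (leq_add _ _).
  apply: leq_trans (mxrank_add _ _) (leq_add _ rN).
  exact: leq_trans (mxrankM_maxl _ _) (mxrankM_maxr _ _).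
have [->|_] := eqVneq l l'; first by rewrite subrr scale0r mxrank0.
by apply: leq_trans (mxrank_scale _ _) _; rewrite mxrank_delta.
Qed.

Lemma mxrank_restr_gain_leq S : (\rank (restr_mx S A) <=
  \rank (restr_mx S (underlying A)) + 2 * theta A S)%N.
Proof.
have [S0|[v _]] := set_0Vmem S.
  suff -> : restr_mx S A = 0 by rewrite mxrank0.
  by apply/matrixP=> i j; rewrite !mxE S0 inE.
by have := mxrank_gain_leq S v 0 0; rewrite !scale0r !addr0 eqxx addn0.
Qed.

(** * Components and edge counts of induced subgraphs *)

(** The retraction [h] carries paths of [T] to paths of [S], so vertices of [S] connected in [T] are
    already connected in [S], and roots inject. *)
Lemma ncomp_retract S T (h : 'I_n -> 'I_n) : S \subset T ->
  {in T, forall x, h x \in S} -> {in S, forall x, h x = x} ->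
  {in T &, forall x y, adjb A x y -> h x = h y \/ adjb A (h x) (h y)} ->
  (ncomp A S <= ncomp A T)%N.
Proof.
move=> ST hT hS hadj; rewrite !ncompE.
have conn x y : connect (edge_on T) x y -> connect (edge_on S) (h x) (h y).
  case/connectP=> p; elim: p x => [|z p IHp] x /=; first by move=> _ ->.
  case/andP=> /and3P[xT zT axz] pz Ey; apply: connect_trans (IHp z pz Ey).
  have [->//|ah] := hadj _ _ xT zT axz.
  by apply: connect1; rewrite /edge_on /= !hT.
have /card_in_imset <- : {in [set x in S | roots (edge_on S) x] &,
    injective (fingraph.root (edge_on T))}.
  move=> x y; rewrite !inE => /andP[xS /eqP rx] /andP[yS /eqP ry] Exy.
  have := conn x y; rewrite !hS // => H.
  rewrite -rx -ry; apply/(fingraph.rootP (connect_edge_on_sym S)); apply: H.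
  exact/(fingraph.rootP (connect_edge_on_sym T)).
apply: subset_leq_card; apply/subsetP=> _ /imsetP[x xS ->].
move: xS; rewrite !inE => /andP[xS _].
rewrite roots_root ?andbT; last exact: connect_edge_on_sym.
exact: connect_edge_on_mem (subsetP ST _ xS) (connect_root _ _).
Qed.

Lemma nedges_add S T (D : {set 'I_n * 'I_n}) : S \subset T ->
  D \subset edges_on T -> {in D, forall p, ~~ ((p.1 \in S) && (p.2 \in S))} ->
  (nedges A S + #|D| <= nedges A T)%N.
Proof.
move=> ST DT DS; rewrite !nedgesE -cardsUI.
rewrite [_ :&: _](_ : _ = set0) ?cards0 ?addn0.
  by apply: subset_leq_card; rewrite subUset DT edges_onS.
apply/setP=> p; rewrite in_setI in_set0; apply/negP=> /andP[pS pD].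
move: pS; rewrite inE => /and3P[p1 p2 _].
by move: (DS _ pD); rewrite p1 p2.
Qed.

(** The representative of an edge in [edges_on], where the smaller end comes first. *)
Definition sorted_pair (x y : 'I_n) := if (x < y)%N then (x, y) else (y, x).

Lemma sorted_pair_mem S x y :
  x \in S -> y \in S -> adjb A x y -> sorted_pair x y \in edges_on S.
Proof.
move=> xS yS xy; rewrite /sorted_pair; case: ltngtP => [lt|lt|/val_inj E].
- by rewrite !inE xS yS lt.
- by rewrite !inE xS yS lt /= adjb_sym.
- by rewrite E adjbxx in xy.
Qed.

Lemma sorted_pair_eq x y z t : sorted_pair x y = sorted_pair z t ->
  (x = z /\ y = t) \/ (x = t /\ y = z).
Proof. by rewrite /sorted_pair; do 2![case: ifP => _] => -[-> ->]; auto. Qed.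

End Switching.

(** * Comparison of theta for F, H and G *)

Section PendantTheta.
Variables (C : numClosedFieldType) (n : nat) (A : 'M[C]_n) (c : seq 'I_n) (v : 'I_n).
Hypotheses (gA : is_gain_graph A) (pc : pendant_cycle A c v).

Let szc : (3 <= size c)%N. Proof. by case: pc. Qed.
Let Uc : uniq c. Proof. by case: pc. Qed.
Let vc : v \in c. Proof. by case: pc. Qed.
Let vF : v \notin Fset c. Proof. by rewrite inE negbK. Qed.

(** H has one more vertex than F and at least the edge [v w] more; retracting [v] onto [w] shows
    that no component is lost. *)
Lemma theta_Fset_leq : (theta A (Fset c) <= theta A (Hset c v))%N.
Proof.
have [w wc wE] := pendant_attach pc.
have FH : Fset c \subset Hset c v by apply: subsetUr.
have vw : adjb A v w by rewrite wE.
have e1 : (nedges A (Fset c) + 1 <= nedges A (Hset c v))%N.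
  rewrite -(cards1 (sorted_pair v w)); apply: nedges_add => //.
    by rewrite sub1set sorted_pair_mem // !inE ?eqxx // wc orbT.
  move=> p /set1P ->; rewrite /sorted_pair.
  by case: ifP => _; rewrite /= (negPf vF) ?andbF.
have c1 : (ncomp A (Fset c) <= ncomp A (Hset c v))%N.
  apply: (@ncomp_retract _ _ _ gA _ _ (fun x => if x == v then w else x)) => //.
  - by move=> x; rewrite !inE; case: eqP.
  - by move=> x; rewrite inE; case: eqP => // ->; rewrite vc.
  move=> x y; rewrite !inE.
  case: (x =P v) => [->|_]; case: (y =P v) => [->|_] /=; [by left| | |by right].
    by move=> _ yc; rewrite wE // => /eqP ->; left.
  by move=> xc _; rewrite adjb_sym // wE // => /eqP ->; left.
by rewrite /theta cardsU1 vF; move: e1 c1; lia.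
Qed.

(** The cycle brings [size c] edges but only [size c - 1] new vertices, and collapsing it onto [v]
    preserves components. *)
Lemma theta_Hset_lt : (theta A (Hset c v) < theta A [set: 'I_n])%N.
Proof.
have HT := subsetT (Hset c v).
pose D := [set sorted_pair y (next c y) | y in c].
have cD : #|D| = size c.
  rewrite card_in_imset; first by rewrite (card_uniqP Uc).
  move=> y z yc zc /sorted_pair_eq[[]//|[yz zy]].
  by have := next_next_neq szc Uc yc; rewrite zy -yz eqxx.
have e1 : (nedges A (Hset c v) + size c <= nedges A setT)%N.
  rewrite -cD; apply: nedges_add => //.
    apply/subsetP=> _ /imsetP[y yc ->]; apply: sorted_pair_mem; rewrite ?inE //.
    exact: (adjb_next pc).
  have nH y : y \in c -> y \in Hset c v -> y = v.
    by rewrite !inE => ->; rewrite orbF => /eqP.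
  move=> _ /imsetP[y yc ->].
  suff H : ~~ ((y \in Hset c v) && (next c y \in Hset c v)).
    by rewrite /sorted_pair; case: ifP => _; rewrite // andbC.
  apply/negP=> /andP[yH nyH].
  have := adjb_next pc yc.
  by rewrite (nH _ _ nyH) ?mem_next // (nH _ yc yH) adjbxx.
have c1 : (ncomp A (Hset c v) <= ncomp A setT)%N.
  apply: (@ncomp_retract _ _ _ gA _ _ (fun x => if x \in c then v else x)) => //.
  - by move=> x _; rewrite !inE; case: ifP => [_|->]; rewrite ?eqxx // orbT.
  - by move=> x; rewrite !inE; case: ifP => // _; rewrite orbF => /eqP.
  move=> x y _ _.
  have [xc|xc] := boolP (x \in c); have [yc|yc] := boolP (y \in c) => axy.
  - by left.
  - have [<-|xv] := eqVneq x v; first by right.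
    by rewrite (cycle_nbr pc xc xv axy) in yc.
  - have [<-|yv] := eqVneq y v; first by right.
    by rewrite adjb_sym // in axy; rewrite (cycle_nbr pc yc yv axy) in xc.
  - by right.
have cF : (#|Fset c| + size c = n)%N.
  have -> : Fset c = ~: [set x in c] by apply/setP=> x; rewrite !inE.
  have <- : #|[set x in c]| = size c by rewrite cardsE; apply/card_uniqP.
  by rewrite addnC cardsC card_ord.
(* Strictness would fail if the subtraction in [theta A (Hset c v)] were truncated at 0. *)
have := card_leq_nedges_ncomp gA (Hset c v).
rewrite /theta cardsT card_ord cardsU1 vF.
by move: e1 c1 cF szc; lia.
Qed.
End PendantTheta.

(** * The underlying graph as a gain graph with all gains 1 *)

Section Underlying.
Variables (C : numClosedFieldType) (n : nat) (A : 'M[C]_n).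

Lemma adjb_underlying : adjb (underlying A) =2 adjb A.
Proof.
by move=> i j; rewrite /adjb mxE /adjb; case: (A i j == 0); rewrite ?eqxx ?oner_eq0.
Qed.

Lemma underlying_gain : is_gain_graph A -> is_gain_graph (underlying A).
Proof.
move=> gA; split.
- by move=> i; rewrite mxE adjbxx.
- by move=> i j; rewrite !mxE adjb_sym // conjC_nat.
- move=> i j; rewrite mxE; case: adjb; rewrite ?eqxx //.
  by rewrite normr1.
Qed.

Lemma underlying_pendant c v : pendant_cycle A c v -> pendant_cycle (underlying A) c v.
Proof.
have degE x : deg (underlying A) x = deg A x.
  by apply: eq_card => y; rewrite !inE adjb_underlying.
case=> szc Uc vc adjc [d3 d2]; split => //.
  by move=> x y xc yc; rewrite adjb_underlying adjc.
by rewrite degE; split => // x xc xv; rewrite degE d2.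
Qed.

Lemma cycle_gain_underlying c v :
  pendant_cycle A c v -> cycle_gain (underlying A) c = 1.
Proof.
move=> pc; rewrite /cycle_gain big_seq big1 // => y yc.
by rewrite mxE (adjb_next pc yc).
Qed.
End Underlying.

(** * Comparison of the ranks in the extremal case *)

Theorem pendant_cycle_extremal (C : numClosedFieldType) n (A : 'M[C]_n)
    (c : seq 'I_n) (v : 'I_n) :
  is_gain_graph A ->
  pendant_cycle A c v ->
  \rank A = (\rank (underlying A) + 2 * theta A [set: 'I_n])%N ->
  [/\ typeB A c /\ (size c %% 4 = 0)%N,
      rank_on (Hset c v) A
        = (rank_on (Hset c v) (underlying A) + 2 * theta A (Hset c v))%N
      /\ rank_on (Fset c) A
        = (rank_on (Fset c) (underlying A) + 2 * theta A (Fset c))%N &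
      [/\ \rank A = (size c + rank_on (Fset c) A)%N,
          rank_on (Fset c) A = rank_on (Hset c v) A,
          \rank (underlying A) = (size c - 2 + rank_on (Hset c v) (underlying A))%N &
          rank_on (Fset c) (underlying A) = rank_on (Hset c v) (underlying A)]].
Proof.
move=> gA pc rA; rewrite !rank_onE.
have gU := underlying_gain gA.
have pU := underlying_pendant pc.
have tF := theta_Fset_leq gA pc.
have tH := theta_Hset_lt gA pc.
have bF := mxrank_restr_gain_leq gA (Fset c).
have bH := mxrank_restr_gain_leq gA (Hset c v).
have FH : Fset c \subset Hset c v by apply: subsetUr.
have mA := mxrank_restr_subset A FH.
have mU := mxrank_restr_subset (underlying A) FH.
have szc : (3 <= size c)%N by case: pc.
have vF : v \notin Fset c by rewrite inE negbK; case: pc.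
have [oddc|evc] := boolP (odd (size c)).
  have [l rA'] := mxrank_pendant_cycle_odd gA pc oddc.
  have [l' rU'] := mxrank_pendant_cycle_odd gU pU oddc.
  have bl := mxrank_gain_leq gA (Hset c v) v l l'.
  (* The looped ranks on H differ by [2 * theta] of G, at least [2 * theta] of H plus 2, whereas
     [bl] allows only plus 1. *)
  by have b1 := leq_b1 (l != l'); exfalso; lia.
have rA' := mxrank_pendant_cycle_even gA pc evc.
have rU' := mxrank_pendant_cycle_even gU pU evc.
rewrite (cycle_gain_underlying pc) in rU'.
have up : (\rank (restr_mx (Hset c v) A) <= \rank (restr_mx (Fset c) A) + 2)%N.
  by apply: mxrank_restrU1 => //; case: gA.
have [odd2|ev2] := boolP (odd (size c)./2).
  move: rU'; rewrite -signr_odd odd2 expr1 eq_sym eqNr oner_eq0 => rU'.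
  (* Here r(G) = p + r(F), while r(Phi) is at most p plus the gain rank of F in both cases, by [up]
     in the first; [bF] and theta(F) < theta(G) contradict equality. *)
  by exfalso; move: rA'; case: ifP => _; lia.
rewrite -signr_odd (negPf ev2) expr0 eqxx in rU'.
have p4 : (size c %% 4 = 0)%N by lia.
move: rA'; case: ifP => [_|tB] rA'; first by exfalso; lia.
(* Writing a subscript A for gain ranks, r_A(F) + 2 = r(H) + 2 theta(G) >= r(H) + 2 theta(H) + 2 >=
   r_A(H) + 2 >= r_A(F) + 2, so all are equalities. Then r_A(F) <= r(F) + 2 theta(F) <= r(H) + 2
   theta(H) is tight as well. *)
by rewrite /typeB evc tB; split; split=> //; lia.
Qed.

Unset Implicit Arguments.

Theorem theorem4p5 (R : realType) (n : nat) (A : 'M[R[i]]_n)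
    (c : seq 'I_n) (v : 'I_n) :
  is_gain_graph A ->
  pendant_cycle A c v ->
  \rank A = (\rank (underlying A) + 2 * theta A [set: 'I_n])%N ->
  [/\ (* (a) *)
      typeB A c /\ (size c %% 4 = 0)%N,
      (* (b) *)
      rank_on (Hset c v) A
        = (rank_on (Hset c v) (underlying A) + 2 * theta A (Hset c v))%N
      /\ rank_on (Fset c) A
        = (rank_on (Fset c) (underlying A) + 2 * theta A (Fset c))%N &
      (* (c) *)
      [/\ \rank A = (size c + rank_on (Fset c) A)%N,
          rank_on (Fset c) A = rank_on (Hset c v) A,
          \rank (underlying A) = (size c - 2 + rank_on (Hset c v) (underlying A))%N &
          rank_on (Fset c) (underlying A) = rank_on (Hset c v) (underlying A)]].
Proof. exact: pendant_cycle_extremal. Qed.
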